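(* Let $\mathcal{V}=\mathbb{ISP}(\mathcal{C})$ be any variety of residuated lattices such that the class $\mathcal{C}$ is closed under canonical extensions and, for every $n\in\mathbb{N}$, $\mathcal{V}\not\models(\mathrm{e}\wedge x)^{n+1}\approx(\mathrm{e}\wedge x)^n$. Then $\mathcal{V}$ is not coherent, does not admit right uniform deductive interpolation, and its first-order theory does not have a model completion.
   Context: A residuated lattice is an algebra $\langle A,\wedge,\vee,\cdot,\backslash,/,\mathrm{e}\rangle$ such that $\langle A,\wedge,\vee\rangle$ is a lattice, $\langle A,\cdot,\mathrm{e}\rangle$ is a monoid, and $b\le a\backslash c\iff a\cdot b\le c\iff a\le c/b$ for all $a,b,c\in A$. $\mathbb{ISP}(\mathcal{C})$ is the class of isomorphic copies of subalgebras of direct products of members of $\mathcal{C}$. Canonical extensions. A completion of a poset $P$ is a complete lattice $C$ with an order embedding of $P$ into $C$ preserving all existing finite meets and joins; $P$ is identified with its image. An element of $C$ is open (resp. closed) if it is a join (resp. meet) in $C$ of a nonempty subset of $P$; $O$ and $K$ denote the sets of open and closed elements. The completion is dense if every element of $C$ is both a join of closed elements and a meet of open elements; it is compact if for all nonempty $A\subseteq K$, $B\subseteq O$: $\bigwedge A\le\bigvee B$ iff $\bigwedge A_0\le\bigvee B_0$ for some finite nonempty $A_0\subseteq A$, $B_0\subseteq B$. A dense compact completion is called the canonical extension $P^\sigma$ of $P$ (unique up to isomorphism fixing $P$). For $f\colon P^n\to P$, the maps $f^\sigma,f^\pi\colon(P^\sigma)^n\to P^\sigma$ are $$f^\sigma(x)=\bigvee\bigl\{\bigwedge\{f(a)\mid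 a\in P^n,\ p\le a\le q\}\mid p\in K^n,\ q\in O^n,\ p\le x\le q\bigr\},$$ $$f^\pi(x)=\bigwedge\bigl\{\bigvee\{f(a)\mid a\in P^n,\ p\le a\le q\}\mid p\in K^n,\ q\in O^n,\ p\le x\le q\bigr\}.$$ The canonical extension of a residuated lattice $\mathbf{A}$ is $\mathbf{A}^\sigma=\langle A^\sigma,\wedge^\sigma,\vee^\sigma,\cdot^\sigma,\backslash^\pi,/^\pi,\mathrm{e}\rangle$, which is again a residuated lattice. $\mathcal{C}$ is closed under canonical extensions if $\mathbf{A}\in\mathcal{C}$ implies $\mathbf{A}^\sigma\in\mathcal{C}$. $\mathcal{V}$ is coherent if every finitely generated subalgebra of a finitely presented member of $\mathcal{V}$ is finitely presented (finitely presented: isomorphic to a quotient of a finitely generated free algebra of $\mathcal{V}$ by a finitely generated congruence). $\Sigma\models_{\mathcal{V}}\varepsilon$ means that every assignment of the variables into any member of $\mathcal{V}$ satisfying all equations in $\Sigma$ satisfies $\varepsilon$. $\mathcal{V}$ admits right uniform deductive interpolation if for any finite disjoint sets of variables $\overline{x},\overline{y}$ and finite set $\Sigma$ of equations in variables $\overline{x},\overline{y}$, there is a finite set $\Pi$ of equations in variables $\overline{y}$ such that for every equation $\varepsilon$ whose variables lie in $\overline{y}$ and a set $\overline{z}$ disjoint from $\overline{x},\overline{y}$: $\Sigma\models_{\mathcal{V}}\varepsilon\iff\Pi\models_{\mathcal{V}}\varepsilon$. A model completion of a theory $T$ is a theory $T^*\supseteq T$ in the same language such that every model of $T$ embeds into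 a model of $T^*$ and, for every model $M$ of $T$, $T^*$ together with the quantifier-free diagram of $M$ is a complete theory. *)

(* Defs.v *)
From mathcomp Require Import all_boot.
From mathcomp Require Import boolp classical_sets cardinality.

Set Implicit Arguments.
Unset Strict Implicit.
Unset Printing Implicit Defensive.

Local Open Scope classical_set_scope.

(* [LDiv] applied to [a], [c] is a \ c; [RDiv] applied to [c], [b] is c / b. *)
Inductive binop := Meet | Join | Mul | LDiv | RDiv.

(* No axioms are imposed here, so that algebras are also the first-order
   structures of the language and quotients and products need no proof that
   axioms are preserved. *)
Record algebra := Algebra {
  carrier :> Type;
  bop : binop -> carrier -> carrier -> carrier;
  ident : carrier }.

Arguments bop {A} o a b : rename.
Arguments ident A : rename.

Definition lattice_le (A : algebra) (a b : A) : Prop := bop Meet a b = a.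

Record residuated_lattice (A : algebra) : Prop := ResiduatedLattice {
  rl_meetC : forall a b : A, bop Meet a b = bop Meet b a;
  rl_meetA : forall a b c : A,
    bop Meet a (bop Meet b c) = bop Meet (bop Meet a b) c;
  rl_joinC : forall a b : A, bop Join a b = bop Join b a;
  rl_joinA : forall a b c : A,
    bop Join a (bop Join b c) = bop Join (bop Join a b) c;
  rl_meetKU : forall a b : A, bop Meet a (bop Join a b) = a;
  rl_joinKI : forall a b : A, bop Join a (bop Meet a b) = a;
  rl_mulA : forall a b c : A, bop Mul a (bop Mul b c) = bop Mul (bop Mul a b) c;
  rl_mul1l : forall a : A, bop Mul (ident A) a = a;
  rl_mul1r : forall a : A, bop Mul a (ident A) = a;
  rl_ldivP : forall a b c : A,
    lattice_le b (bop LDiv a c) <-> lattice_le (bop Mul a b) c;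
  rl_rdivP : forall a b c : A,
    lattice_le (bop Mul a b) c <-> lattice_le a (bop RDiv c b) }.

Definition hom (A B : algebra) (h : A -> B) : Prop :=
  (forall o a b, h (bop o a b) = bop o (h a) (h b)) /\ h (ident A) = ident B.

Definition isomorphic (A B : algebra) : Prop :=
  exists h : A -> B, hom h /\ bijective h.

Definition subuniverse (A : algebra) (S : set A) : Prop :=
  S (ident A) /\ forall o a b, S a -> S b -> S (bop o a b).

Definition subalgebra (A : algebra) (S : set A) (subS : subuniverse S) :
    algebra :=
  @Algebra {a : A | S a}
    (fun o x y => exist S (bop o (sval x) (sval y))
                    (subS.2 o _ _ (svalP x) (svalP y)))
    (exist S (ident A) subS.1).

Definition product (I : Type) (F : I -> algebra) : algebra :=
  @Algebra (forall i, F i) (fun o x y i => bop o (x i) (y i))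
    (fun i => ident (F i)).

Definition generated_sub (A : algebra) (X : set A) : set A :=
  [set a | forall S : set A, subuniverse S -> X `<=` S -> S a].

Lemma generated_subP (A : algebra) (X : set A) : subuniverse (generated_sub X).
Proof.
split=> [S [S1 _] _|o a b Sa Sb S subS XS] //.
by apply: subS.2; [exact: Sa|exact: Sb].
Qed.

Record congruence (A : algebra) (th : A -> A -> Prop) : Prop := Congruence {
  congr_refl : forall a, th a a;
  congr_sym : forall a b, th a b -> th b a;
  congr_trans : forall a b c, th a b -> th b c -> th a c;
  congr_bop : forall o a a' b b',
    th a a' -> th b b' -> th (bop o a b) (bop o a' b') }.

Definition generated_congruence (A : algebra) (R : set (A * A)) (a b : A) :
    Prop :=
  forall th : A -> A -> Prop, congruence th ->
    (forall c d, R (c, d) -> th c d) -> th a b.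

Lemma generated_congruenceP (A : algebra) (R : set (A * A)) :
  congruence (generated_congruence R).
Proof.
split=> [a|a b ab|a b c ab bc|o a a' b b' aa' bb'] th cth Rth.
- exact: (congr_refl cth).
- by apply: (congr_sym cth); exact: ab.
- by apply: (congr_trans cth) (ab _ cth Rth) (bc _ cth Rth).
- by apply: (congr_bop cth); [exact: aa'|exact: bb'].
Qed.

(* The blocks of [th]; a block is a predicate [A -> Prop] (rather than [set A],
   which would raise the universe of the carrier). *)
Definition block (A : algebra) (th : A -> A -> Prop) : Type :=
  {c : A -> Prop | exists a, c = th a}.

Definition block_of (A : algebra) (th : A -> A -> Prop) (a : A) : block th :=
  exist _ (th a) (ex_intro _ a erefl).

Lemma block_bop_subproof (A : algebra) (th : A -> A -> Prop) :
  congruence th -> forall o (x y : block th),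
  exists a, (fun z => exists b c, [/\ sval x b, sval y c & th (bop o b c) z])
            = th a.
Proof.
move=> cth o [x [a xE]] [y [b yE]] /=; exists (bop o a b); rewrite xE yE.
apply/funext => z; apply/propext; split=> [[a' [b' [aa' bb' zE]]]|abz].
  by apply: (congr_trans cth) zE; apply: (congr_bop cth).
by exists a, b; split=> //; exact: (congr_refl cth).
Qed.

Definition quotient (A : algebra) (th : A -> A -> Prop) (cth : congruence th) :
    algebra :=
  @Algebra (block th)
    (fun o x y => exist _ _ (block_bop_subproof cth o x y))
    (block_of th (ident A)).

Lemma quotient_bopE (A : algebra) (th : A -> A -> Prop) (cth : congruence th)
    o (a b : A) :
  @bop (quotient cth) o (block_of th a) (block_of th b)
  = block_of th (bop o a b).
Proof.
apply: eq_exist => /=; apply/funext => z; apply/propext.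
split=> [[a' [b' [aa' bb' zE]]]|abz].
  by apply: (congr_trans cth) zE; apply: (congr_bop cth).
by exists a, b; split=> //; exact: (congr_refl cth).
Qed.

Definition class := algebra -> Prop.

Definition Iop (K : class) : class :=
  fun A => exists B, K B /\ isomorphic A B.

Definition Sop (K : class) : class :=
  fun A => exists (B : algebra) (S : set B) (subS : subuniverse S),
    K B /\ A = subalgebra subS.

Definition Pop (K : class) : class :=
  fun A => exists (I : Type) (F : I -> algebra),
    (forall i, K (F i)) /\ A = product F.

Definition ISP (K : class) : class := Iop (Sop (Pop K)).

Inductive term (X : Type) : Type :=
| Var of X
| Ident
| Bop of binop & term X & term X.

Arguments Ident {X}.

Fixpoint eval (X : Type) (A : algebra) (v : X -> A) (t : term X) : A :=
  match t with
  | Var x => v x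
  | Ident => ident A
  | Bop o s t => bop o (eval v s) (eval v t)
  end.

Fixpoint tvars (X : Type) (t : term X) : set X :=
  match t with
  | Var x => [set x]
  | Ident => set0
  | Bop _ s t => tvars s `|` tvars t
  end.

Fixpoint map_term (X Y : Type) (f : X -> Y) (t : term X) : term Y :=
  match t with
  | Var x => Var (f x)
  | Ident => Ident
  | Bop o s t => Bop o (map_term f s) (map_term f t)
  end.

Fixpoint term_pow (X : Type) (t : term X) (n : nat) : term X :=
  if n is m.+1 then Bop Mul t (term_pow t m) else Ident.

Definition equation : Type := term nat * term nat.

Definition eqn_vars (eps : equation) : set nat := tvars eps.1 `|` tvars eps.2.

Definition eqn_holds (A : algebra) (v : nat -> A) (eps : equation) : Prop :=
  eval v eps.1 = eval v eps.2.

Definition eqn_valid (V : class) (eps : equation) : Prop :=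
  forall A, V A -> forall v : nat -> A, eqn_holds v eps.

Definition eqn_entails (V : class) (Sigma : set equation) (eps : equation) :
    Prop :=
  forall A, V A -> forall v : nat -> A,
    (forall delta, Sigma delta -> eqn_holds v delta) -> eqn_holds v eps.

Definition variety (V : class) : Prop :=
  exists E : set equation, forall A,
    V A <-> forall eps, E eps -> forall v : nat -> A, eqn_holds v eps.

Definition neg_potent_eqn (n : nat) : equation :=
  let t := Bop Meet Ident (Var 0) in (term_pow t n.+1, term_pow t n).

Definition right_uniform_deductive_interpolation (V : class) : Prop :=
  forall xs ys : set nat,
  finite_set xs -> finite_set ys -> xs `&` ys = set0 ->
  forall Sigma : set equation, finite_set Sigma ->
  (forall delta, Sigma delta -> eqn_vars delta `<=` xs `|` ys) ->
  exists Pi : set equation,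
    [/\ finite_set Pi,
        forall delta, Pi delta -> eqn_vars delta `<=` ys
      & forall (zs : set nat) (eps : equation),
          zs `&` (xs `|` ys) = set0 -> eqn_vars eps `<=` ys `|` zs ->
          (eqn_entails V Sigma eps <-> eqn_entails V Pi eps)].

Definition free_algebra (V : class) (X : Type) (F : algebra) (g : X -> F) :
    Prop :=
  V F /\ forall (A : algebra) (f : X -> A), V A ->
    exists! h : F -> A, hom h /\ forall x, h (g x) = f x.

Definition finitely_presented (V : class) (A : algebra) : Prop :=
  exists (n : nat) (F : algebra) (g : 'I_n -> F) (R : set (F * F)),
    [/\ free_algebra V g, finite_set R
      & isomorphic A (quotient (generated_congruenceP R))].

Definition coherent (V : class) : Prop :=
  forall A : algebra, V A -> finitely_presented V A ->
  forall X : set A, finite_set X ->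
    finitely_presented V (subalgebra (generated_subP X)).

(* First-order formulas of the language expanded by a constant for each element
   of [D]: in terms, [Var (inl d)] is the constant named by [d] and
   [Var (inr n)] is the n-th variable. *)
Inductive formula (D : Type) : Type :=
| FEq of term (D + nat) & term (D + nat)
| FBot
| FImp of formula D & formula D
| FAll of nat & formula D.

Arguments FBot {D}.

Definition FNot (D : Type) (phi : formula D) : formula D := FImp phi FBot.

Definition update (A : Type) (v : nat -> A) (n : nat) (a : A) : nat -> A :=
  fun k => if k == n then a else v k.

Definition with_constants (D A : Type) (d : D -> A) (v : nat -> A) (x : D + nat)
    : A :=
  match x with inl c => d c | inr n => v n end.

Fixpoint holds (D : Type) (A : algebra) (d : D -> A) (v : nat -> A)
    (phi : formula D) : Prop :=
  match phi with
  | FEq s t => eval (with_constants d v) s = eval (with_constants d v) t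
  | FBot => False
  | FImp phi psi => holds d v phi -> holds d v psi
  | FAll n phi => forall a : A, holds d (update v n a) phi
  end.

Fixpoint free_vars (D : Type) (phi : formula D) : set nat :=
  match phi with
  | FEq s t => [set n | (tvars s `|` tvars t) (inr n)]
  | FBot => set0
  | FImp phi psi => free_vars phi `|` free_vars psi
  | FAll n phi => free_vars phi `\ n
  end.

Definition sentence (D : Type) (phi : formula D) : Prop := free_vars phi = set0.

Fixpoint quantifier_free (D : Type) (phi : formula D) : Prop :=
  match phi with
  | FEq _ _ | FBot => True
  | FImp phi psi => quantifier_free phi /\ quantifier_free psi
  | FAll _ _ => False
  end.

Fixpoint map_formula (D D' : Type) (f : D -> D') (phi : formula D) :
    formula D' :=
  let g (x : D + nat) := match x with inl c => inl (f c) | inr n => inr n end in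
  match phi with
  | FEq s t => FEq (map_term g s) (map_term g t)
  | FBot => FBot
  | FImp phi psi => FImp (map_formula f phi) (map_formula f psi)
  | FAll n phi => FAll n (map_formula f phi)
  end.

Definition theory (D : Type) (T : set (formula D)) : Prop :=
  forall phi, T phi -> sentence phi.

Definition model (D : Type) (T : set (formula D)) (A : algebra) (d : D -> A) :
    Prop :=
  forall phi, T phi -> forall v : nat -> A, holds d v phi.

Definition fo_entails (D : Type) (T : set (formula D)) (phi : formula D) :
    Prop :=
  forall (A : algebra) (d : D -> A), model T d ->
  forall v : nat -> A, holds d v phi.

Definition complete_theory (D : Type) (T : set (formula D)) : Prop :=
  (exists (A : algebra) (d : D -> A), model T d) /\
  forall phi, sentence phi -> fo_entails T phi \/ fo_entails T (FNot phi).

Definition diagram (M : algebra) : set (formula M) :=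
  [set phi | [/\ quantifier_free phi, sentence phi
               & forall v : nat -> M, holds id v phi]].

Definition Th (V : class) : set (formula void) :=
  [set phi | sentence phi /\
             forall A, V A -> forall v : nat -> A, holds (of_void A) v phi].

Definition model_completion (T Tstar : set (formula void)) : Prop :=
  [/\ theory Tstar,
      T `<=` Tstar,
      forall M : algebra, model T (of_void M) ->
        exists (N : algebra) (h : M -> N),
          [/\ model Tstar (of_void N), hom h & injective h]
    & forall M : algebra, model T (of_void M) ->
        complete_theory ([set map_formula (of_void M) phi | phi in Tstar]
                         `|` @diagram M)].

Definition is_lub (T : Type) (le : T -> T -> Prop) (S : set T) (x : T) : Prop :=
  (forall y, S y -> le y x) /\ forall z, (forall y, S y -> le y z) -> le x z.

Definition is_glb (T : Type) (le : T -> T -> Prop) (S : set T) (x : T) : Prop :=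
  (forall y, S y -> le x y) /\ forall z, (forall y, S y -> le z y) -> le z x.

Definition partial_order (T : Type) (le : T -> T -> Prop) : Prop :=
  [/\ forall x, le x x,
      forall x y, le x y -> le y x -> x = y
    & forall x y z, le x y -> le y z -> le x z].

Definition complete_lattice (T : Type) (le : T -> T -> Prop) : Prop :=
  partial_order le /\
  forall S : set T, (exists x, is_lub le S x) /\ (exists x, is_glb le S x).

Definition completion (P C : Type) (leP : P -> P -> Prop)
    (leC : C -> C -> Prop) (i : P -> C) : Prop :=
  [/\ complete_lattice leC,
      forall a b, leP a b <-> leC (i a) (i b)
    & forall S : set P, finite_set S ->
        (forall a, is_glb leP S a -> is_glb leC (i @` S) (i a)) /\
        (forall a, is_lub leP S a -> is_lub leC (i @` S) (i a))].

Definition open_elt (P C : Type) (leC : C -> C -> Prop) (i : P -> C) : set C :=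
  [set x | exists S : set P, S !=set0 /\ is_lub leC (i @` S) x].

Definition closed_elt (P C : Type) (leC : C -> C -> Prop) (i : P -> C) :
    set C :=
  [set x | exists S : set P, S !=set0 /\ is_glb leC (i @` S) x].

Definition dense_completion (P C : Type) (leC : C -> C -> Prop) (i : P -> C) :
    Prop :=
  forall x : C,
    (exists S, S `<=` closed_elt leC i /\ is_lub leC S x) /\
    (exists S, S `<=` open_elt leC i /\ is_glb leC S x).

Definition meet_le_join (C : Type) (leC : C -> C -> Prop) (A B : set C) : Prop :=
  forall m j, is_glb leC A m -> is_lub leC B j -> leC m j.

Definition compact_completion (P C : Type) (leC : C -> C -> Prop) (i : P -> C) :
    Prop :=
  forall A B : set C, A !=set0 -> B !=set0 ->
    A `<=` closed_elt leC i -> B `<=` open_elt leC i ->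
    (meet_le_join leC A B <->
     exists A0 B0 : set C,
       [/\ finite_set A0 /\ finite_set B0, A0 !=set0 /\ B0 !=set0,
           A0 `<=` A, B0 `<=` B & meet_le_join leC A0 B0]).

Definition canonical_extension (P C : Type) (leP : P -> P -> Prop)
    (leC : C -> C -> Prop) (i : P -> C) : Prop :=
  [/\ completion leP leC i, dense_completion leC i & compact_completion leC i].

(* The sigma- and pi-extensions are only needed for binary operations, the
   constant e being extended by its image. *)

Definition le2 (C : Type) (leC : C -> C -> Prop) (x y : C * C) : Prop :=
  leC x.1 y.1 /\ leC x.2 y.2.

Definition interval_image (P C : Type) (leC : C -> C -> Prop) (i : P -> C)
    (f : P -> P -> P) (p q : C * C) : set C :=
  [set c | exists a b : P,
     [/\ le2 leC p (i a, i b), le2 leC (i a, i b) q & c = i (f a b)]].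

Definition bracket (P C : Type) (leC : C -> C -> Prop) (i : P -> C)
    (x p q : C * C) : Prop :=
  [/\ closed_elt leC i p.1 /\ closed_elt leC i p.2,
      open_elt leC i q.1 /\ open_elt leC i q.2,
      le2 leC p x & le2 leC x q].

Definition sigma_extension (P C : Type) (leC : C -> C -> Prop) (i : P -> C)
    (f : P -> P -> P) (g : C -> C -> C) : Prop :=
  forall x y : C,
    is_lub leC [set u | exists p q, bracket leC i (x, y) p q /\
                          is_glb leC (interval_image leC i f p q) u]
           (g x y).

Definition pi_extension (P C : Type) (leC : C -> C -> Prop) (i : P -> C)
    (f : P -> P -> P) (g : C -> C -> C) : Prop :=
  forall x y : C,
    is_glb leC [set u | exists p q, bracket leC i (x, y) p q /\
                          is_lub leC (interval_image leC i f p q) u]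
           (g x y).

(* [B] is the canonical extension of the residuated lattice [A], up to
   isomorphism. *)
Definition rl_canonical_extension (A B : algebra) : Prop :=
  exists (leB : B -> B -> Prop) (i : A -> B),
    canonical_extension (@lattice_le A) leB i /\
    [/\ sigma_extension leB i (@bop A Meet) (@bop B Meet),
        sigma_extension leB i (@bop A Join) (@bop B Join)
      & sigma_extension leB i (@bop A Mul) (@bop B Mul)] /\
    [/\ pi_extension leB i (@bop A LDiv) (@bop B LDiv),
        pi_extension leB i (@bop A RDiv) (@bop B RDiv)
      & ident B = i (ident A)].

(* Canonical extensions being defined up to isomorphism, and [K] not being
   assumed closed under isomorphism, only some copy has to lie in [K]. *)
Definition closed_under_canonical_extensions (K : class) : Prop :=
  forall A, K A -> exists B, K B /\ rl_canonical_extension A B.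

(* Main.v *)
(* Put c = e /\ z and let Sigma(x, w, z) be w <= x <= e, c x = x. Sigma entails
   w <= c^n for every n. Conversely, if w <= c^n for all n in some member of V,
   then that member embeds into a member of V in which Sigma has a solution x:
   embed it into a product of members of C and take in each canonical extension
   the meet of all c^n, which multiplication by c fixes by compactness.
   So eliminating x from Sigma gives exactly the infinite list w <= c^n, and it
   is not equivalent to a finite part of itself: for each n some A_n in V
   satisfies w_n <= c_n^n but not w_n <= c_n^(n+1).
   Let P be a nonprincipal ultraproduct of the A_n; there w <= c^k for all k.
   - A finite set Pi interpolating Sigma holds in P, hence in some A_n.
   - If the subalgebra D generated by w, z of the algebra presented by Sigma is
     finitely presented, the homomorphism from D to P lifts to some A_n.
   - For a model completion T*, take the A_n to be models of T*; then P is a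
     model of T* without a solution of Sigma, although it embeds into a model
     of T* with one, and T* with the diagram of P is not complete. *)
From mathcomp Require Import all_boot.
From mathcomp Require Import boolp classical_sets cardinality filter.
Require Import Defs.

Set Implicit Arguments.
Unset Strict Implicit.
Unset Printing Implicit Defensive.

Local Open Scope classical_set_scope.

(** * Finite sets, directed sets and filters *)

Lemma finite_set_ind (T : Type) (P : set T -> Prop) :
  P set0 -> (forall x S, P S -> P (x |` S)) -> forall S, finite_set S -> P S.
Proof.
(* [{classic T}] supplies the decidable equality needed to list [S]. *)
move=> P0 PU S /(@finite_seqP {classic T}) [s ->].
elim: s => [|x s IHs]; first by rewrite set_nil.
suff -> : [set` x :: s] = x |` [set` s] by exact: PU.
apply/seteqP; split=> y /=; rewrite inE; first by case/predU1P; [left|right].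
by case=> [->|ys]; rewrite ?eqxx ?ys ?orbT.
Qed.

(** Replaces the finite subset that compactness yields by a single element of a directed set. *)
Lemma finite_lower_bound (T : Type) (R : T -> T -> Prop) (S S0 : set T) :
  (forall a b c, R a b -> R b c -> R a c) -> S !=set0 ->
  (forall a b, S a -> S b -> exists c, [/\ S c, R c a & R c b]) ->
  finite_set S0 -> S0 `<=` S -> exists2 c, S c & forall a, S0 a -> R c a.
Proof.
move=> Rtr [s Ss] Sdir S0fin.
elim/finite_set_ind: S0 / S0fin => [|x S0 IH] S0S; first by exists s.
have [|c Sc cS0] := IH; first by move=> y S0y; apply: S0S; right.
have [|d [Sd dc dx]] := Sdir c x Sc; first by apply: S0S; left.
by exists d => // y [->//|S0y]; exact: Rtr dc (cS0 _ S0y).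
Qed.

Lemma filter_finite (T X : Type) (F : set_system T) (S : set X)
    (Q : X -> set T) :
  Filter F -> finite_set S -> (forall x, S x -> F (Q x)) ->
  F [set t | forall x, S x -> Q x t].
Proof.
move=> FF Sfin; elim/finite_set_ind: S / Sfin => [|x S IH] SQ.
  by apply: filterS filterT => t _ y.
have FS : F [set t | forall x, S x -> Q x t].
  by apply: IH => y Sy; apply: SQ; right.
apply: filterS (filterI (SQ x _) FS); last by left.
by move=> t [Qx Qt] y [->//|]; exact: Qt.
Qed.

(** * Order and powers of negative elements in a residuated lattice *)

Fixpoint power (A : algebra) (a : A) (n : nat) : A :=
  if n is m.+1 then bop Mul a (power a m) else ident A.

Definition negpart (A : algebra) (a : A) : A := bop Meet (ident A) a.

Section ResiduatedLattice.

Variables (A : algebra) (Arl : residuated_lattice A).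
Implicit Types a b c d : A.
Local Notation "a <=l b" := (lattice_le a b) (at level 70).

Lemma le_refl a : a <=l a.
Proof. by rewrite /lattice_le -{2}(rl_joinKI Arl a a) rl_meetKU. Qed.

Lemma le_trans a b c : a <=l b -> b <=l c -> a <=l c.
Proof. by rewrite /lattice_le => <- bc; rewrite -rl_meetA // bc. Qed.

Lemma le_antisym a b : a <=l b -> b <=l a -> a = b.
Proof. by move=> ab ba; rewrite -[LHS]ab rl_meetC. Qed.

Lemma meet_lel a b : bop Meet a b <=l a.
Proof.
by rewrite /lattice_le rl_meetC // rl_meetA // (le_refl a : bop Meet a a = a).
Qed.

Lemma meet_ler a b : bop Meet a b <=l b.
Proof. by rewrite rl_meetC //; exact: meet_lel. Qed.

Lemma le_meet a b c : a <=l b -> a <=l c -> a <=l bop Meet b c.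
Proof. by rewrite /lattice_le => ab ac; rewrite rl_meetA // ab. Qed.

Lemma meet_glb a b : is_glb (@lattice_le A) [set a; b] (bop Meet a b).
Proof.
split=> [c [] ->|c cab]; [exact: meet_lel|exact: meet_ler|].
by apply: le_meet; apply: cab; [left|right].
Qed.

Lemma meet_mono a b c d :
  a <=l c -> b <=l d -> bop Meet a b <=l bop Meet c d.
Proof.
move=> ac bd; apply: le_meet; first exact: le_trans (meet_lel a b) ac.
exact: le_trans (meet_ler a b) bd.
Qed.

(** By residuation every translation is a lower adjoint, hence monotone; the factors are enlarged
    one at a time. *)
Lemma mul_mono a b c d : a <=l c -> b <=l d -> bop Mul a b <=l bop Mul c d.
Proof.
move=> ac bd; apply: (@le_trans _ (bop Mul c b)).
  by apply/(rl_rdivP Arl); apply: le_trans ac _; apply/(rl_rdivP Arl)/le_refl.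
by apply/(rl_ldivP Arl); apply: le_trans bd _; apply/(rl_ldivP Arl)/le_refl.
Qed.

Lemma powerS_le a n : power (negpart a) n.+1 <=l power (negpart a) n.
Proof.
rewrite /= -{2}(rl_mul1l Arl (power _ n)).
by apply: mul_mono (meet_lel _ _) (le_refl _).
Qed.

Lemma power_le a m n :
  (m <= n)%N -> power (negpart a) n <=l power (negpart a) m.
Proof.
elim: n => [|n IHn]; first by case: m => // _; exact: le_refl.
rewrite leq_eqVlt => /predU1P [-> |mn]; first exact: le_refl.
by apply: le_trans (powerS_le _ _) (IHn _).
Qed.

End ResiduatedLattice.

(** * Canonical extensions *)

Section CanonicalExtension.

Variables (A B : algebra) (leB : B -> B -> Prop) (i : A -> B).
Hypotheses (Arl : residuated_lattice A)
  (AB : canonical_extension (@lattice_le A) leB i).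
Local Notation "a <=a b" := (lattice_le a b) (at level 70).
Local Notation "x <=b y" := (leB x y) (at level 70).

Let leBP : partial_order leB. Proof. by have [[[]]] := AB. Qed.
Let refl x : x <=b x. Proof. by have [] := leBP. Qed.
Let antisym x y : x <=b y -> y <=b x -> x = y.
Proof. by have [_ + _] := leBP; exact. Qed.
Let trans x y z : x <=b y -> y <=b z -> x <=b z.
Proof. by have [_ _] := leBP; exact. Qed.
Let le_i a b : a <=a b <-> i a <=b i b.
Proof. by have [[]] := AB. Qed.

Let lubE S x y : is_lub leB S x -> is_lub leB S y -> x = y.
Proof. by move=> [xS xl] [yS yl]; apply: antisym; [exact: xl|exact: yl]. Qed.
Let glbE S x y : is_glb leB S x -> is_glb leB S y -> x = y.
Proof. by move=> [xS xl] [yS yl]; apply: antisym; [exact: yl|exact: xl]. Qed.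
Let glb_ex S : exists x, is_glb leB S x.
Proof. by have [[[_ /(_ S)[]]]] := AB. Qed.
Let lub_ex S : exists x, is_lub leB S x.
Proof. by have [[[_ /(_ S)[]]]] := AB. Qed.

Lemma canonical_inj a b : i a = i b -> a = b.
Proof.
by move=> ab; apply: (le_antisym Arl); apply/le_i; rewrite ab; exact: refl.
Qed.

Lemma le_i_meet x a b : x <=b i a -> x <=b i b -> x <=b i (bop Meet a b).
Proof.
move=> xa xb; have [[_ _ i_lim] _ _] := AB.
have [/(_ _ (meet_glb Arl a b))[_ glb] _] := i_lim _ (finite_set2 a b).
by apply: glb => _ [c [] -> <-].
Qed.

Lemma open_i a : open_elt leB i (i a).
Proof.
exists [set a]; split; first by exists a.
by split=> [_ [_ -> <-]//|z]; apply; exists a.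
Qed.

Lemma closed_i a : closed_elt leB i (i a).
Proof.
exists [set a]; split; first by exists a.
by split=> [_ [_ -> <-]//|z]; apply; exists a.
Qed.

Lemma compact_directed (S : set A) x q :
  S !=set0 ->
  (forall a b, S a -> S b -> exists c, [/\ S c, c <=a a & c <=a b]) ->
  is_glb leB (i @` S) x -> open_elt leB i q -> x <=b q ->
  exists2 a, S a & i a <=b q.
Proof.
move=> [s Ss] Sdir xS [T [[t Tt] qT]] xq.
have [_ _ ABc] := AB; have [||||+ _] := ABc (i @` S) (i @` T).
- by exists (i s), s.
- by exists (i t), t.
- by move=> _ [a _ <-]; exact: closed_i.
- by move=> _ [a _ <-]; exact: open_i.
case=> [m j mS jT|A0 [B0 [[A0f _] _ A0S B0T A0B0]]].
  by rewrite (glbE mS xS) (lubE jT qT).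
have [||c [a Sa <-] aA0] := finite_lower_bound trans _ _ A0f A0S.
- by exists (i s), s.
- move=> _ _ [a Sa <-] [b Sb <-]; have [c [Sc ca cb]] := Sdir a b Sa Sb.
  by exists (i c); split; [exists c|apply/le_i|apply/le_i].
(* [meet_le_join] quantifies over meets and joins, so these have to be produced; completeness gives
   them. *)
exists a => //; have [m mA0] := glb_ex A0; have [j jB0] := lub_ex B0.
apply: trans (mA0.2 _ aA0) _; apply: trans (A0B0 m j mA0 jB0) _.
by apply: jB0.2 => y B0y; apply: qT.1; exact: B0T.
Qed.

(** The elements of [A] above the closed [p] are directed downwards with meet [p], so compactness
    puts one of them below [q]. Its meet with [a] is still above [p]. *)
Lemma interpolate p q a :
  closed_elt leB i p -> open_elt leB i q -> p <=b q -> p <=b i a ->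
  exists b, [/\ p <=b i b, i b <=b q & b <=a a].
Proof.
move=> [S [[s Ss] pS]] qo pq pa.
have [|||b pb bq] := @compact_directed [set b | p <=b i b] p q _ _ _ qo pq.
- by exists a.
- move=> b c pb pc; exists (bop Meet b c); split; first exact: le_i_meet.
    exact: meet_lel.
  exact: meet_ler.
- split=> [_ [b pb <-]//|z zp]; apply: pS.2 => _ [b Sb <-].
  by apply: zp; exists b => //; apply: pS.1; exists b.
exists (bop Meet b a); split; [exact: le_i_meet| |exact: meet_ler].
by apply: trans bq; apply/le_i/meet_lel.
Qed.

(** [(i a, i b)] is closed and open, so it can be both ends of a bracket, whose interval is then the
    single pair [(a, b)]. Every other bracket around it has [f a b] among its values. *)
Lemma sigma_extension_i f g a b :
  sigma_extension leB i f g -> g (i a) (i b) = i (f a b).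
Proof.
move=> /(_ (i a) (i b)) gE; apply: lubE gE _; split=> [u|z].
  by move=> [p [q [[_ _ pab abq] [uI _]]]]; apply: uI; exists a, b.
apply; exists (i a, i b), (i a, i b); split.
  by split; split; rewrite //=; by [exact: closed_i|exact: open_i].
split=> [_ [c [d [[/= ac bd] [/= ca db] ->]]]|u]; last first.
  by apply; exists a, b; split.
by rewrite (canonical_inj (antisym ac ca)) (canonical_inj (antisym bd db)).
Qed.

(** The same degenerate bracket works with joins and meets exchanged. *)
Lemma pi_extension_i f g a b :
  pi_extension leB i f g -> g (i a) (i b) = i (f a b).
Proof.
move=> /(_ (i a) (i b)) gE; apply: glbE gE _; split=> [u|z].
  by move=> [p [q [[_ _ pab abq] [uI _]]]]; apply: uI; exists a, b.
apply; exists (i a, i b), (i a, i b); split.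
  by split; split; rewrite //=; by [exact: closed_i|exact: open_i].
split=> [_ [c [d [[/= ac bd] [/= ca db] ->]]]|u]; last first.
  by apply; exists a, b; split.
by rewrite (canonical_inj (antisym ac ca)) (canonical_inj (antisym bd db)).
Qed.

(** Closed arguments can be taken as the lower end of a bracket, and the upper end does not matter:
    by [interpolate], each value of [f] above the lower end dominates one taken inside the
    bracket. *)
Lemma sigma_extension_closed f g x y t :
  sigma_extension leB i f g ->
  (forall a b c d, a <=a c -> b <=a d -> f a b <=a f c d) ->
  closed_elt leB i x -> closed_elt leB i y ->
  is_glb leB
    [set u | exists a b, [/\ x <=b i a, y <=b i b & u = i (f a b)]] t ->
  g x y = t.
Proof.
move=> /(_ x y) gE fmono xc yc tE; apply: lubE gE _; split=> [u|z zU].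
  move=> [p [q [[[pc1 pc2] [qo1 qo2] [/= px py] [/= xq yq]] [uI _]]]].
  apply: tE.2 => _ [a [b [xa yb ->]]].
  have [a' [pa' aq' aa']] := interpolate pc1 qo1 (trans px xq) (trans px xa).
  have [b' [pb' bq' bb']] := interpolate pc2 qo2 (trans py yq) (trans py yb).
  apply: (@trans _ (i (f a' b'))); first by apply: uI; exists a', b'.
  by apply/le_i; exact: fmono.
(* A bracket still needs some open upper end; members of the nonempty families defining [x] and [y]
   provide it. *)
have [S [[s Ss] xS]] := xc; have [T [[r Tr] yT]] := yc.
have xs : x <=b i s by apply: xS.1; exists s.
have yr : y <=b i r by apply: yT.1; exists r.
have [u uE] := glb_ex (interval_image leB i f (x, y) (i s, i r)).
apply: (@trans _ u); last first.
  apply: zU; exists (x, y), (i s, i r); split=> //.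
  by split; split=> //=; exact: open_i.
by apply: uE.2 => _ [a [b [[/= xa yb] _ ->]]]; apply: tE.1; exists a, b.
Qed.

(** The meet of a canonical extension is given as a sigma-extension only. This case links it to
    [leB] as far as the two inequalities of Sigma require. *)
Lemma sigma_meet_closed g x y :
  sigma_extension leB i (@bop A Meet) g ->
  closed_elt leB i x -> closed_elt leB i y -> x <=b y -> g x y = x.
Proof.
move=> gE xc yc xy; have [S [_ xS]] := xc; have [T [[r Tr] yT]] := yc.
apply: (sigma_extension_closed gE (meet_mono Arl) xc yc); split.
  by move=> _ [a [b [xa yb ->]]]; apply: le_i_meet => //; exact: trans yb.
move=> z zI; apply: xS.2 => _ [s Ss <-].
apply: (@trans _ (i (bop Meet s r))); last by apply/le_i/meet_lel.
apply: zI; exists s, r; split=> //; first by apply: xS.1; exists s.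
by apply: yT.1; exists r.
Qed.

(** Write c for [negpart z]. If c <= a and x <= b, then c^n <= b for some n by compactness, so x <=
    c^(n+1) <= a b. Conversely the products c c^n = c^(n+1) <= c^n are among the values whose meet
    is c x. *)
Lemma sigma_mul_power g z x :
  sigma_extension leB i (@bop A Mul) g ->
  is_glb leB (i @` range (power (negpart z))) x -> g (i (negpart z)) x = x.
Proof.
move=> gE xE; have xc : closed_elt leB i x.
  by exists (range (power (negpart z))); split=> //; exists (ident A), 0.
apply: (sigma_extension_closed gE (mul_mono Arl) (closed_i _) xc); split.
  move=> _ [a [b [ca xb ->]]].
  have [||_ [n _ <-] nb] := compact_directed _ _ xE (open_i b) xb.
  - by exists (ident A), 0.
  - move=> _ _ [m _ <-] [n _ <-]; exists (power (negpart z) (maxn m n)).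
    by split; [exists (maxn m n)|apply: power_le => //; exact: leq_maxl
      |apply: power_le => //; exact: leq_maxr].
  apply: (@trans _ (i (power (negpart z) n.+1))).
    by apply: xE.1; exists (power (negpart z) n.+1) => //; exists n.+1.
  by apply/le_i/(mul_mono Arl); apply/le_i.
move=> u uI; apply: xE.2 => _ [_ [n _ <-] <-].
apply: (@trans _ (i (power (negpart z) n.+1))); last by apply/le_i/powerS_le.
apply: uI; exists (negpart z), (power (negpart z) n); split=> //.
by apply: xE.1; exists (power (negpart z) n) => //; exists n.
Qed.

End CanonicalExtension.

(** * Homomorphisms, varieties and reduced products *)

Section Homomorphisms.

Variables (A B : algebra) (h : A -> B).
Hypothesis h_hom : hom h.

Lemma hom_eval (X : Type) (v : X -> A) t : h (eval v t) = eval (h \o v) t.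
Proof.
elim: t => [//||o s IHs t IHt] /=; first by rewrite h_hom.2.
by rewrite h_hom.1 IHs IHt.
Qed.

Lemma hom_negpart a : h (negpart a) = negpart (h a).
Proof. by rewrite /negpart h_hom.1 h_hom.2. Qed.

Lemma hom_power a n : h (power a n) = power (h a) n.
Proof. by elim: n => [|n IHn] /=; rewrite ?h_hom.2 // h_hom.1 IHn. Qed.

Lemma hom_negpower a n : h (power (negpart a) n) = power (negpart (h a)) n.
Proof. by rewrite hom_power hom_negpart. Qed.

Lemma hom_le a b : lattice_le a b -> lattice_le (h a) (h b).
Proof. by rewrite /lattice_le -h_hom.1 => ->. Qed.

Lemma hom_le_inj a b : injective h -> lattice_le (h a) (h b) -> lattice_le a b.
Proof. by move=> h_inj; rewrite /lattice_le -h_hom.1 => /h_inj. Qed.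

Lemma hom_kernel : congruence (fun a b => h a = h b).
Proof.
by split=> [//|//|a b c -> //|o a a' b b' ha hb]; rewrite !h_hom.1 ha hb.
Qed.

Lemma generated_congruence_kernel (R : set (A * A)) a b :
  (forall c d, R (c, d) -> h c = h d) -> generated_congruence R a b ->
  h a = h b.
Proof. by move=> hR ab; exact: ab hom_kernel hR. Qed.

End Homomorphisms.

Lemma hom_comp (A B D : algebra) (g : B -> D) (h : A -> B) :
  hom g -> hom h -> hom (g \o h).
Proof.
move=> g_hom h_hom; split=> [o a b|] /=; first by rewrite h_hom.1 g_hom.1.
by rewrite h_hom.2 g_hom.2.
Qed.

Lemma eval_ext (X : Type) (A : algebra) (u v : X -> A) t :
  (forall x, tvars t x -> u x = v x) -> eval u t = eval v t.
Proof.
elim: t => [x|//|o s IHs t IHt] /= uv; first exact: uv.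
by rewrite IHs ?IHt // => x xt; apply: uv; [right|left].
Qed.

Lemma eval_term_pow (X : Type) (A : algebra) (v : X -> A) t n :
  eval v (term_pow t n) = power (eval v t) n.
Proof. by elim: n => [|n IHn] //=; rewrite IHn. Qed.

Lemma tvars_term_pow (X : Type) (t : term X) n :
  tvars (term_pow t n) `<=` tvars t.
Proof. by elim: n => [|n IHn] //= x [|/IHn]. Qed.

Lemma proj_hom (I : Type) (F : I -> algebra) i :
  hom (fun x : product F => x i).
Proof. by []. Qed.

Lemma sval_hom (A : algebra) (S : set A) (subS : subuniverse S) :
  hom (fun x : subalgebra subS => sval x).
Proof. by []. Qed.

Section Quotient.

Variables (A : algebra) (th : A -> A -> Prop) (cth : congruence th).

Definition quotient_map : A -> quotient cth := block_of th.

Lemma quotient_map_hom : hom quotient_map.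
Proof. by split=> // o a b; rewrite [RHS]quotient_bopE. Qed.

Lemma quotient_mapE a b : quotient_map a = quotient_map b <-> th a b.
Proof.
split=> [[->]|ab]; first exact: congr_refl.
apply: eq_exist; apply/funext => c; apply/propext; split.
  by move=> ac; apply: congr_trans (congr_sym cth ab) ac.
exact: congr_trans ab.
Qed.

Lemma quotient_map_surj (x : quotient cth) : exists a, quotient_map a = x.
Proof. by case: x => c [a ca]; exists a; apply: eq_exist. Qed.

Lemma quotient_lift (B : algebra) (f : A -> B) :
  hom f -> (forall a b, th a b -> f a = f b) ->
  exists2 h : quotient cth -> B, hom h & forall a, h (quotient_map a) = f a.
Proof.
move=> f_hom f_th.
(* The value of [f] at a chosen representative of the block. *)
pose h x := f (sval (cid (quotient_map_surj x))).
have hE a : h (quotient_map a) = f a.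
  apply/f_th/quotient_mapE.
  exact: (svalP (cid (quotient_map_surj (quotient_map a)))).
exists h => //; split=> [o x y|]; last by rewrite -f_hom.2 -hE.
have [a <-] := quotient_map_surj x; have [b <-] := quotient_map_surj y.
by rewrite -quotient_map_hom.1 !hE f_hom.1.
Qed.

End Quotient.

Section Variety.

Variables (V : class) (V_variety : variety V).

Lemma variety_surj (A B : algebra) (h : A -> B) :
  hom h -> (forall b, exists a, h a = b) -> V A -> V B.
Proof.
have [E VE] := V_variety => h_hom h_surj /VE AE; apply/VE => eps Eeps v.
have [u uE] := choice (fun n => h_surj (v n)).
have -> : v = h \o u by apply/funext => n /=; rewrite uE.
by rewrite /eqn_holds -!hom_eval // AE.
Qed.

Lemma variety_product (I : Type) (F : I -> algebra) :
  (forall i, V (F i)) -> V (product F).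
Proof.
have [E VE] := V_variety => VF; apply/VE => eps Eeps v.
apply: functional_extensionality_dep => i.
by rewrite !(hom_eval (proj_hom F i)); move/VE: (VF i); exact.
Qed.

Lemma variety_quotient (A : algebra) (th : A -> A -> Prop)
  (cth : congruence th) : V A -> V (quotient cth).
Proof.
by apply: variety_surj (quotient_map_hom _) _; exact: quotient_map_surj.
Qed.

Definition term_algebra (X : Type) : algebra :=
  @Algebra (term X) (@Bop X) Ident.

Lemma eval_hom (X : Type) (A : algebra) (v : X -> A) :
  @hom (term_algebra X) A (eval v).
Proof. by []. Qed.

Definition valid_eq (X : Type) (s t : term_algebra X) : Prop :=
  forall A, V A -> forall v : X -> A, eval v s = eval v t.

Lemma valid_eq_congruence (X : Type) : congruence (@valid_eq X).
Proof.
split=> [//|s t st A VA v|r s t rs st A VA v|o s s' t t' ss' tt' A VA v] /=.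
- by rewrite st.
- by rewrite rs ?st.
- by rewrite ss' ?tt'.
Qed.

(** Terms modulo the identities valid in [V]. The quotient satisfies the equations defining [V]
    because a valuation in it lifts to a substitution of terms. *)
Lemma free_algebra_exists (X : Type) :
  exists (F : algebra) (g : X -> F), free_algebra V g.
Proof.
pose q := quotient_map (@valid_eq_congruence X).
exists (quotient (@valid_eq_congruence X)), (q \o @Var X); split.
  have [E VE] := V_variety; apply/VE => eps Eeps v.
  have [u uE] := choice (fun n => quotient_map_surj (v n)).
  have -> : v = q \o u by apply/funext => n /=; rewrite -uE.
  rewrite /eqn_holds -!hom_eval; try exact: quotient_map_hom.
  apply/quotient_mapE => A /VE AE a.
  by rewrite !(hom_eval (eval_hom a)); exact: AE.
move=> A f VA.
have [|h h_hom hE] := quotient_lift (@valid_eq_congruence X) (eval_hom f).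
  by move=> s t; apply.
exists h; split=> [|k [k_hom kE]]; first by split=> // x; rewrite hE.
apply/funext => y; have [t <-] := quotient_map_surj y; rewrite hE.
(* A term is its own value at the variables, so [k] is determined by its values on the
   generators. *)
rewrite -[t in RHS](_ : eval (A := term_algebra X) (@Var X) t = t); last first.
  by elim: t => [//|//|o s IHs t IHt] /=; rewrite IHs IHt.
rewrite (hom_eval (quotient_map_hom _)) hom_eval //.
by apply: eval_ext => x _ /=; rewrite kE.
Qed.

End Variety.

Section ReducedProduct.

Variables (I : Type) (A : I -> algebra) (U : set_system I).

Definition almost_eq (f g : product A) : Prop := U [set n | f n = g n].

Hypothesis U_filter : Filter U.

Lemma almost_eq_congruence : congruence almost_eq.
Proof.
split=> [f|f g|f g h fg gh|o f f' g g' ff' gg'].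
- by apply: filterS filterT.
- by apply: filterS => n /= ->.
- by apply: filterS (filterI fg gh) => n [/= -> ->].
- by apply: filterS (filterI ff' gg') => n [/= -> ->].
Qed.

Definition reduced_product : algebra := quotient almost_eq_congruence.

Definition class_of : product A -> reduced_product :=
  quotient_map almost_eq_congruence.

Lemma class_of_hom : hom class_of.
Proof. exact: quotient_map_hom. Qed.

Lemma class_of_surj x : exists a, class_of a = x.
Proof. exact: quotient_map_surj. Qed.

Lemma reduced_product_eval (X : Type) (v : X -> product A) s t :
  eval (class_of \o v) s = eval (class_of \o v) t <->
  U [set n | eval (fun x => v x n) s = eval (fun x => v x n) t].
Proof.
rewrite -!(hom_eval class_of_hom) quotient_mapE /almost_eq.
by under eq_set => n do rewrite !(hom_eval (proj_hom A n)).
Qed.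

End ReducedProduct.

Lemma with_constants_comp (D : Type) (A B : Type) (h : A -> B) (d : D -> A) v :
  with_constants (h \o d) (h \o v) = h \o with_constants d v.
Proof. by apply/funext => -[]. Qed.

Lemma update_comp (A B : Type) (h : A -> B) (v : nat -> A) k a :
  update (h \o v) k (h a) = h \o update v k a.
Proof. by apply/funext => n; rewrite /update /=; case: eqP. Qed.

(** Łoś's theorem. Maximality of [U] is used for one direction of implication and of the universal
    quantifier. *)
Lemma ultraproduct_holds (I D : Type) (A : I -> algebra) (U : set_system I)
    (U_ultra : UltraFilter U) (d : D -> product A) phi v :
  holds (class_of _ \o d) (@class_of I A U _ \o v) phi <->
  U [set n | holds (fun c => d c n) (fun k => v k n) phi].
Proof.
elim: phi v => [s t||phi IHphi psi IHpsi|k phi IHphi] v /=.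
- rewrite with_constants_comp reduced_product_eval.
  suff E n : with_constants d v ^~ n = with_constants (d^~ n) (v^~ n).
    by under eq_set => n do rewrite E.
  by apply/funext => -[].
- by split=> // /filter_ex[].
- rewrite IHphi IHpsi; split=> [imp|imp Uphi].
    have [/imp|] :=
      in_ultra_setVsetC [set n | holds (d^~ n) (v^~ n) phi] U_ultra.
      by apply: filterS => n psin.
    by apply: filterS => n /= phiN /phiN.
  by apply: filterS (filterI imp Uphi) => n [] /= + phin; exact.
- split=> [all|all x]; last first.
    have [a <-] := class_of_surj x; rewrite update_comp; apply/IHphi.
    apply: filterS all => n /= /(_ (a n)).
    by rewrite (update_comp (fun f : product A => f n)).
  have [//|notall] := in_ultra_setVsetC
    [set n | forall a, holds (d^~ n) (update (v^~ n) k a) phi] U_ultra.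
  (* A counterexample is chosen at each index where one exists; elsewhere [v k n] is the default
     value. *)
  have E n : exists a, ~ (forall a, holds (d^~ n) (update (v^~ n) k a) phi) ->
      ~ holds (d^~ n) (update (v^~ n) k a) phi.
    have [alln|/existsNP[a aN]] := pselect
      (forall a, holds (d^~ n) (update (v^~ n) k a) phi); last by exists a.
    by exists (v k n).
  have [a aP] : exists a : product A, forall n,
      ~ (forall b, holds (d^~ n) (update (v^~ n) k b) phi) ->
      ~ holds (d^~ n) (update (v^~ n) k (a n)) phi.
    by exists (fun n => sval (cid (E n))) => n; exact: (svalP (cid (E n))).
  have Ua := (IHphi (update v k a)).1.
  rewrite -(update_comp (class_of _)) in Ua.
  have {}Ua := Ua (all (class_of _ a)).
  have [n [/= /aP]] := filter_ex (filterI notall Ua).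
  by rewrite (update_comp (fun f : product A => f n)).
Qed.

(** * The system Sigma and its solutions in canonical extensions *)

Definition fixpoint_system (A : algebra) (w z x : A) : Prop :=
  [/\ bop Meet w x = w, bop Meet x (ident A) = x & bop Mul (negpart z) x = x].

(** By induction x <= c^n: x <= e is the case n = 0, and x = c x <= c c^n is the step. *)
Lemma fixpoint_bound (A : algebra) (w z x : A) n :
  residuated_lattice A -> fixpoint_system w z x ->
  lattice_le w (power (negpart z) n).
Proof.
move=> Arl [wx xe zx]; apply: (le_trans Arl wx).
elim: n => [//|n IHn]; rewrite -zx.
by apply: mul_mono => //; exact: le_refl.
Qed.

Lemma hom_fixpoint_system (A B : algebra) (h : A -> B) w z x :
  hom h -> fixpoint_system w z x -> fixpoint_system (h w) (h z) (h x).
Proof.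
move=> h_hom [wx xe zx]; split; last by rewrite -hom_negpart // -h_hom.1 zx.
  by rewrite -h_hom.1 wx.
by rewrite -h_hom.2 -h_hom.1 xe.
Qed.

Lemma canonical_fixpoint (A B : algebra) :
  residuated_lattice A -> rl_canonical_extension A B ->
  exists i : A -> B, [/\ hom i, injective i
    & forall w z, (forall n, lattice_le w (power (negpart z) n)) ->
      exists x, fixpoint_system (i w) (i z) x].
Proof.
move=> Arl [leB [i [AB [[meetE joinE mulE] [ldivE rdivE identE]]]]].
have i_hom : hom i.
  split=> // -[] a b; symmetry.
  - exact: (sigma_extension_i Arl AB).
  - exact: (sigma_extension_i Arl AB).
  - exact: (sigma_extension_i Arl AB).
  - exact: (pi_extension_i Arl AB).
  - exact: (pi_extension_i Arl AB).
exists i; split=> // [a b|w z wz]; first exact: (canonical_inj Arl AB).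
(* The solution [x] is the meet of the images of all powers of [negpart z]. It is below e because e
   is the power with exponent 0. *)
have [[[_ /(_ (i @` range (power (negpart z)))) [_ [x xE]]] le_i _] _ _] := AB.
have xc : closed_elt leB i x.
  by exists (range (power (negpart z))); split=> //; exists (ident A), 0.
exists x; split.
- apply: (sigma_meet_closed Arl AB meetE) => //; first exact: (closed_i AB).
  by apply: xE.2 => _ [_ [n _ <-] <-]; apply/le_i.
- rewrite identE; apply: (sigma_meet_closed Arl AB meetE) => //.
    exact: (closed_i AB).
  by apply: xE.1; exists (ident A) => //; exists 0.
- by rewrite -hom_negpart //; exact: (sigma_mul_power Arl AB mulE xE).
Qed.

(** * Members of [ISP C] as subalgebras of products *)

Lemma ISP_product (C : class) (I : Type) (F : I -> algebra) :
  (forall i, C (F i)) -> ISP C (product F).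
Proof.
move=> CF; have subT : @subuniverse (product F) setT by [].
(* Carriers of members of [Sop] are subset types, so the product is reached through its full
   subalgebra. *)
exists (subalgebra subT); split.
  by exists (product F), setT, subT; split=> //; exists I, F.
exists (fun x => exist _ x Logic.I); split.
  by split=> [o a b|]; exact: eq_exist.
by exists sval => // -[x []]; apply: eq_exist.
Qed.

Lemma ISP_embed (C : class) (A : algebra) :
  ISP C A -> exists (I : Type) (F : I -> algebra) (h : A -> product F),
    [/\ forall i, C (F i), hom h & injective h].
Proof.
move=> [_ [[D [S [subS [[I [F [CF DE]]] ->]]]] [h [h_hom h_bij]]]].
subst D.
exists I, F, (sval \o h); split=> //; first exact: hom_comp h_hom.
move=> a b /= hab; apply: (bij_inj h_bij).
by case: (h a) (h b) hab => [x Sx] [y Sy] /= xy; exact: eq_exist.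
Qed.

(** Since [h] is injective, equalities and inequalities, and with them all the axioms, can be tested
    in each coordinate. *)
Lemma ISP_residuated (C : class) (A : algebra) :
  (forall B, C B -> residuated_lattice B) -> ISP C A -> residuated_lattice A.
Proof.
move=> C_rl /ISP_embed [I [F [h [CF h_hom h_inj]]]].
have Frl i := C_rl _ (CF i).
have sep a b : (forall i, h a i = h b i) -> a = b.
  by move=> hab; apply/h_inj/functional_extensionality_dep.
have hE o a b i : h (bop o a b) i = bop o (h a i) (h b i) by rewrite h_hom.1.
have h1 i : h (ident A) i = ident (F i) by rewrite h_hom.2.
have leE a b : lattice_le a b <-> forall i, lattice_le (h a i) (h b i).
  split=> [ab i|ab]; first by rewrite /lattice_le -hE ab.
  by apply: sep => i; rewrite hE ab.
split=> [a b|a b c|a b|a b c|a b|a b|a b c|a|a|a b c|a b c].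
- by apply: sep => i; rewrite !hE rl_meetC.
- by apply: sep => i; rewrite !hE rl_meetA.
- by apply: sep => i; rewrite !hE rl_joinC.
- by apply: sep => i; rewrite !hE rl_joinA.
- by apply: sep => i; rewrite !hE rl_meetKU.
- by apply: sep => i; rewrite !hE rl_joinKI.
- by apply: sep => i; rewrite !hE rl_mulA.
- by apply: sep => i; rewrite !hE h1 rl_mul1l.
- by apply: sep => i; rewrite !hE h1 rl_mul1r.
- rewrite !leE; split=> ab i; have := ab i; rewrite !hE;
    by move/(rl_ldivP (Frl i)).
- rewrite !leE; split=> ab i; have := ab i; rewrite !hE;
    by move/(rl_rdivP (Frl i)).
Qed.

(** Variables 0, 1 and 2 stand for x, w and z. *)
Definition fixpoint_eqns : set equation :=
  [set (Bop Meet (Var 1) (Var 0), Var 1); (Bop Meet (Var 0) Ident, Var 0);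
       (Bop Mul (Bop Meet Ident (Var 2)) (Var 0), Var 0)].

Definition assign (A : algebra) (x w z : A) (k : nat) : A :=
  match k with 0 => x | 1 => w | _ => z end.

Lemma fixpoint_eqnsP (A : algebra) (v : nat -> A) :
  (forall delta, fixpoint_eqns delta -> eqn_holds v delta) <->
  fixpoint_system (v 1) (v 2) (v 0).
Proof.
split=> [vE|[wx xe zx] _ [[->|->]|->] //].
split; first exact: (vE _ (or_introl (or_introl erefl))).
  exact: (vE _ (or_introl (or_intror erefl))).
exact: (vE _ (or_intror erefl)).
Qed.

Lemma reduced_product_fixpoint (I : Type) (A : I -> algebra)
    (U : set_system I) (UF : Filter U) (w z x : product A) :
  fixpoint_system (class_of UF w) (class_of UF z) (class_of UF x) ->
  U [set n | fixpoint_system (w n) (z n) (x n)].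
Proof.
have cl_hom := class_of_hom A UF.
rewrite /fixpoint_system -cl_hom.2 -(hom_negpart cl_hom) -!cl_hom.1.
case=> /quotient_mapE Uw /quotient_mapE Ue /quotient_mapE Uz.
by apply: filterS (filterI Uw (filterI Ue Uz)) => n [wx [xe zx]].
Qed.

(** * First-order formulas *)

Lemma eval_map_term (X Y : Type) (A : algebra) (f : X -> Y) (v : Y -> A) t :
  eval v (map_term f t) = eval (v \o f) t.
Proof. by elim: t => [//|//|o s IHs t IHt] /=; rewrite IHs IHt. Qed.

Lemma tvars_map_term (X Y : Type) (f : X -> Y) t :
  tvars (map_term f t) = f @` tvars t.
Proof.
elim: t => [x||o s IHs t IHt] /=; rewrite ?image_set1 ?image_set0 //.
by rewrite IHs IHt image_setU.
Qed.

Lemma tvars_bounded (t : term nat) :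
  exists N, forall x, tvars t x -> (x < N)%N.
Proof.
elim: t => [x||o s [M sM] t [N tN]]; [by exists x.+1 => _ ->|by exists 0|].
exists (maxn M N) => x [/sM|/tN] xN; rewrite leq_max xN //.
by rewrite orbT.
Qed.

Lemma holds_ext (D : Type) (A : algebra) (d : D -> A) (u v : nat -> A) phi :
  (forall n, free_vars phi n -> u n = v n) ->
  holds d u phi <-> holds d v phi.
Proof.
elim: phi u v => [s t||phi IHphi psi IHpsi|k phi IHphi] u v /= uv //.
- by rewrite (@eval_ext _ _ _ (with_constants d v) s) 1?(@eval_ext _ _ _
    (with_constants d v) t) // => -[c|n] st //=; apply: uv; [right|left].
- by rewrite (IHphi u v) 1?(IHpsi u v) // => n nP; apply: uv; [right|left].
- suff E a : holds d (update u k a) phi <-> holds d (update v k a) phi.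
    by split=> all a; apply/E.
  by apply: IHphi => n nphi; rewrite /update; case: eqP => // nk; apply: uv.
Qed.

Lemma holds_sentence (D : Type) (A : algebra) (d : D -> A) (u v : nat -> A)
    phi : sentence phi -> holds d u phi -> holds d v phi.
Proof. by move=> phi0; apply: (holds_ext _ _).1 => n; rewrite phi0. Qed.

Lemma holds_map_formula (D E : Type) (A : algebra) (f : D -> E) (d : E -> A) v
    phi : holds d v (map_formula f phi) <-> holds (d \o f) v phi.
Proof.
elim: phi v => [s t||phi IHphi psi IHpsi|k phi IHphi] v //=.
- rewrite !eval_map_term.
  by have -> : with_constants (d \o f) v = with_constants d v \o
    (fun x => match x with inl c => inl (f c) | inr n => inr n end)
    by apply/funext => -[].
- by rewrite IHphi IHpsi.
- by split=> all a; apply/IHphi.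
Qed.

Lemma holds_embedding (D : Type) (A B : algebra) (h : A -> B) (d : D -> A) v
    phi : hom h -> injective h -> quantifier_free phi ->
  holds (h \o d) (h \o v) phi <-> holds d v phi.
Proof.
move=> h_hom h_inj; elim: phi => [s t _||phi IHphi psi IHpsi [? ?]|] //=.
  by rewrite with_constants_comp -!hom_eval //; split=> [/h_inj|->].
by rewrite IHphi ?IHpsi.
Qed.

(** Universal closure, which is a sentence as soon as [N] bounds the free variables. *)
Fixpoint closure (D : Type) (N : nat) (phi : formula D) : formula D :=
  if N is M.+1 then FAll M (closure M phi) else phi.

Lemma free_vars_closure (D : Type) N (phi : formula D) n :
  free_vars (closure N phi) n -> free_vars phi n /\ (N <= n)%N.
Proof.
elim: N => [//|N IHN] /= [/IHN [phin Nn] /= nN]; split=> //.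
by rewrite ltn_neqAle Nn andbT eq_sym; apply/eqP.
Qed.

Lemma holds_closure (D : Type) (A : algebra) (d : D -> A) N phi :
  (forall v, holds d v (closure N phi)) <-> (forall v, holds d v phi).
Proof.
elim: N => [//|N <-] /=; split=> all v; last by move=> a; exact: all.
have := all v (v N); rewrite (_ : update v N (v N) = v) //.
by apply/funext => k; rewrite /update; case: eqP => // ->.
Qed.

Lemma of_void_comp (A B : Type) (h : A -> B) : h \o of_void A = of_void B.
Proof. by apply/funext => -[]. Qed.

(** The universal closures of the equations defining [V] belong to [Th V]. *)
Lemma model_Th (V : class) (A : algebra) :
  variety V -> model (Th V) (of_void A) <-> V A.
Proof.
move=> [E VE]; split=> [AT|VA phi [_ phiV]]; last exact: phiV.
apply/VE => eps Eeps v.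
have [M eps1M] := tvars_bounded eps.1; have [N eps2N] := tvars_bounded eps.2.
pose phi : formula void :=
  FEq (map_term inr eps.1) (map_term inr eps.2).
have holdsE (B : algebra) (u : nat -> B) :
    holds (of_void B) u phi <-> eqn_holds u eps.
  by rewrite /= !eval_map_term.
apply/holdsE; move: v; apply/(holds_closure _ (maxn M N)) => v.
apply: AT; split=> [|B /VE BE]; last first.
  by apply/holds_closure => u; apply/holdsE/BE.
rewrite /sentence -subset0 => n /free_vars_closure [].
rewrite /= !tvars_map_term geq_max => + /andP [Mn Nn].
by case=> -[x xeps [xn]]; subst x; [have := eps1M _ xeps|have := eps2N _ xeps];
  rewrite ltnNge ?Mn ?Nn.
Qed.

(** The sentence that [Tstar] with the diagram of the ultraproduct will fail to decide. *)
Definition no_fixpoint_formula (D : Type) (w z : D) : formula D :=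
  let x := Var (inr 0) in let w := Var (inl w) in let z := Var (inl z) in
  FAll 0 (FImp (FEq (Bop Meet w x) w) (FImp (FEq (Bop Meet x Ident) x)
    (FImp (FEq (Bop Mul (Bop Meet Ident z) x) x) FBot))).

Lemma no_fixpoint_sentence (D : Type) (w z : D) :
  sentence (no_fixpoint_formula w z).
Proof.
rewrite /sentence -subset0 => n [/= + n0].
by repeat case=> //; case=> /n0.
Qed.

Lemma no_fixpointP (D : Type) (A : algebra) (d : D -> A) v (w z : D) :
  holds d v (no_fixpoint_formula w z) <->
  forall x, ~ fixpoint_system (d w) (d z) x.
Proof.
by split=> [no x [wx xe zx]|no /= x wx xe zx]; [exact: (no x)|apply: (no x)].
Qed.

(** * Solving Sigma in extensions, and algebras where it has no solution *)

Section Counterexample.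

Variables V C : class.
Hypotheses (C_rl : forall A, C A -> residuated_lattice A)
  (V_ISP : forall A, V A <-> ISP C A)
  (V_variety : variety V)
  (C_canonical : closed_under_canonical_extensions C)
  (V_not_potent : forall n : nat, ~ eqn_valid V (neg_potent_eqn n)).

Lemma V_rl A : V A -> residuated_lattice A.
Proof. by move=> /V_ISP; exact: ISP_residuated. Qed.

Lemma fixpoint_embedding (A : algebra) (w z : A) :
  V A -> (forall n, lattice_le w (power (negpart z) n)) ->
  exists (B : algebra) (j : A -> B) (x : B),
    [/\ V B, hom j, injective j & fixpoint_system (j w) (j z) x].
Proof.
move=> /V_ISP /ISP_embed [I [F [h [CF h_hom h_inj]]]] wz.
have H i : exists (B : algebra) (k : F i -> B) (x : B),
    [/\ C B, hom k, injective k & fixpoint_system (k (h w i)) (k (h z i)) x].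
  have [B [CB FB]] := C_canonical (CF i).
  have [k [k_hom k_inj kfix]] := canonical_fixpoint (C_rl (CF i)) FB.
  have [|x xE] := kfix (h w i) (h z i); last by exists B, k, x.
  move=> n; pose hi a := h a i.
  have hi_hom : hom hi by exact: (hom_comp (proj_hom F i) h_hom).
  by rewrite -[h w i]/(hi w) -(hom_negpower hi_hom); exact: hom_le.
(* Choice of an extension, an embedding and a solution in every coordinate. *)
pose B i := sval (cid (H i)); pose Hk i := svalP (cid (H i)).
pose k i : F i -> B i := sval (cid (Hk i)).
pose x i : B i := sval (cid (svalP (cid (Hk i)))).
have xP i : [/\ C (B i), hom (k i), injective (k i)
    & fixpoint_system (k i (h w i)) (k i (h z i)) (x i)].
  exact: (svalP (cid (svalP (cid (Hk i))))).
exists (product B), (fun a i => k i (h a i)), x; split.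
- by apply/V_ISP/ISP_product => i; have [] := xP i.
- split=> [o a b|]; apply: functional_extensionality_dep => i;
    have [_ k_hom _ _] := xP i; first by rewrite h_hom.1 k_hom.1.
  by rewrite h_hom.2 k_hom.2.
- move=> a b ab; apply/h_inj/functional_extensionality_dep => i.
  by have [_ _ k_inj _] := xP i; apply: k_inj; exact: (congr1 (@^~ i) ab).
- split; apply: functional_extensionality_dep => i;
    have [_ _ _ [wx xe zx]] := xP i; [exact: wx|exact: xe|exact: zx].
Qed.

(** Witnesses that the conditions w <= c^k for k <= n do not imply the next one. *)
Definition power_gap n (A : algebra) (w z : A) : Prop :=
  (forall k, (k <= n)%N -> lattice_le w (power (negpart z) k)) /\
  ~ lattice_le w (power (negpart z) n.+1).

Lemma power_gap_exists :
  exists (A : nat -> algebra) (w z : forall n, A n),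
    forall n, V (A n) /\ power_gap n (w n) (z n).
Proof.
have H n : exists (A : algebra) (w z : A), V A /\ power_gap n w z.
  have /existsNP [A /not_implyP [VA /existsNP [v vN]]] := @V_not_potent n.
  have Arl := V_rl VA.
  (* Take w = c^n at a valuation where c^(n+1) and c^n differ: c^(n+1) <= c^n always holds, so the
     converse inequality fails. *)
  exists A, (power (negpart (v 0)) n), (v 0); split=> //; split=> [k kn|le].
    exact: power_le.
  apply: vN; rewrite /eqn_holds !eval_term_pow.
  exact: (le_antisym Arl (powerS_le Arl _ _)).
exists (fun n => sval (cid (H n))), (fun n => sval (cid (svalP (cid (H n))))).
exists (fun n => sval (cid (svalP (cid (svalP (cid (H n))))))) => n.
exact: (svalP (cid (svalP (cid (svalP (cid (H n))))))).
Qed.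

Lemma power_gap_hom n (A B : algebra) (h : A -> B) w z :
  hom h -> injective h -> power_gap n w z -> power_gap n (h w) (h z).
Proof.
move=> h_hom h_inj [wz wzN]; split=> [k kn|].
  by rewrite -hom_negpower //; apply: hom_le => //; exact: wz.
by rewrite -hom_negpower // => /(hom_le_inj h_hom h_inj)/wzN.
Qed.

(** For fixed k, w <= c^k holds at every index n >= k, hence on a member of [U]. So it holds in the
    reduced product for all k, and [fixpoint_embedding] applies. *)
Lemma power_gap_ultraproduct (A : nat -> algebra) (w z : product A)
    (U : set_system nat) (UF : Filter U) :
  \oo `<=` U -> (forall n, V (A n) /\ power_gap n (w n) (z n)) ->
  exists (B : algebra) (j : reduced_product A UF -> B) (x : B),
    [/\ V B, hom j, injective j
      & fixpoint_system (j (class_of UF w)) (j (class_of UF z)) x].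
Proof.
move=> ooU gap; apply: fixpoint_embedding => [|k].
  apply: (variety_quotient V_variety).
  by apply: (variety_product V_variety) => n; have [] := gap n.
rewrite /lattice_le -(hom_negpower (class_of_hom A _)) -(class_of_hom A _).1.
apply/quotient_mapE/ooU; exists k => // n /= kn.
rewrite (hom_negpower (proj_hom A n)).
by have [_ [+ _]] := gap n; exact.
Qed.

Lemma power_gap_no_fixpoint n (A : algebra) (w z x : A) :
  V A -> power_gap n w z -> ~ fixpoint_system w z x.
Proof.
by move=> /V_rl Arl [_ wzN] xE; apply: wzN; exact: fixpoint_bound xE.
Qed.

(** * Failure of right uniform deductive interpolation *)

Lemma no_right_uniform_deductive_interpolation :
  ~ right_uniform_deductive_interpolation V.
Proof.
move=> rudi.
have [|||Pi [Pi_fin Pi_vars PiE]] :=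
    @rudi [set 0] [set 1; 2] (finite_set1 _) (finite_set2 _ _) _ fixpoint_eqns.
- by apply/seteqP; split=> // n [/= -> []].
- by rewrite /fixpoint_eqns !finite_setU; do !split; exact: finite_set1.
- move=> _ [[->|->]|->] n; rewrite /eqn_vars /=;
    by do ?[case=> //]; move=> ->; by [left|right; left|right; right].
have {}PiE eps : eqn_vars eps `<=` [set 1; 2] ->
    eqn_entails V fixpoint_eqns eps <-> eqn_entails V Pi eps.
  by move=> eps_vars; apply: (PiE set0); rewrite ?set0I // => n /eps_vars; left.
have [A [w [z gap]]] := power_gap_exists.
have [U [U_ultra ooU]] := ultraFilterLemma eventually_filter.
have [B [j [x [VB j_hom j_inj xE]]]] := power_gap_ultraproduct _ ooU gap.
(* [Pi] entails its own members, so Sigma does too and they hold in [B]. They mention only w and z,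
   so they descend along the injective [j] to the ultraproduct and then hold on a member of [U]. The
   value [w n] of variable 0 is a dummy. *)
have UPi delta : Pi delta ->
    U [set n | eqn_holds (assign (w n) (w n) (z n)) delta].
  move=> Pi_delta.
  pose a : nat -> product A := assign (w : product A) w z.
  suff : U [set n | eqn_holds (fun k => a k n) delta].
    apply: filterS => n /=; suff -> : a^~ n = assign (w n) (w n) (z n) by [].
    by apply/funext => -[|[|k]].
  apply/reduced_product_eval; apply: j_inj; rewrite !hom_eval //.
  have /PiE : eqn_vars delta `<=` [set 1; 2] by exact: Pi_vars.
  case=> _ /(_ (fun A VA v vPi => vPi _ Pi_delta)) /(_ B VB).
  move=> /(_ (assign x (j (class_of _ w)) (j (class_of _ z)))).
  move=> /(_ ((fixpoint_eqnsP _).2 xE)).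
  rewrite /eqn_holds; have vE k : [set 1; 2] k ->
    assign x (j (class_of _ w)) (j (class_of _ z)) k
    = (j \o (class_of _ \o a)) k by case=> ->.
  rewrite (@eval_ext _ _ _ (j \o (class_of _ \o a)) delta.1); last first.
    by move=> k kd; apply: vE; apply: Pi_vars Pi_delta _ _; left.
  rewrite (@eval_ext _ _ _ (j \o (class_of _ \o a)) delta.2) //.
  by move=> k kd; apply: vE; apply: Pi_vars Pi_delta _ _; right.
have [n nPi] := filter_ex (filter_finite ultra_proper Pi_fin UPi).
have [VA [_ wzN]] := gap n; apply: wzN.
(* The inequality w <= c^(n+1), which follows from Sigma but fails in [A n], where all of [Pi]
   holds. *)
pose eps : equation :=
  (Bop Meet (Var 1) (term_pow (Bop Meet Ident (Var 2)) n.+1), Var 1).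
have eps_vars : eqn_vars eps `<=` [set 1; 2].
  (* The power is abstracted so that simplification does not unfold it. *)
  rewrite /eqn_vars /eps; move Et: (term_pow _ n.+1) => t k /=.
  rewrite -Et {t Et}.
  by case=> [[->|kt]|->]; [left|right; have [] := tvars_term_pow kt|left].
have Sigma_eps : eqn_entails V fixpoint_eqns eps.
  move=> D VD v /fixpoint_eqnsP vE.
  rewrite /eqn_holds /eps; move Et: (term_pow _ n.+1) => t /=.
  rewrite -Et eval_term_pow.
  exact: (fixpoint_bound n.+1 (V_rl VD) vE).
have := (PiE _ eps_vars).1 Sigma_eps _ VA _ nPi.
rewrite /eqn_holds /eps; move Et: (term_pow _ n.+1) => t /=.
by rewrite -Et eval_term_pow.
Qed.

(** * Finite presentations and the failure of coherence *)

Lemma finitely_presented_quotient (n : nat) (F : algebra) (g : 'I_n -> F)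
    (R : set (F * F)) :
  free_algebra V g -> finite_set R ->
  finitely_presented V (quotient (generated_congruenceP R)).
Proof.
move=> Fg Rfin; exists n, F, g, R; split=> //.
by exists id; split=> //; exists id.
Qed.

(** Lifting the images of the generators gives a map [r] from the free algebra to the product. The
    finitely many relations hold together on a member of [U], and there the coordinates of [r]
    factor through [D]. [S] prescribes finitely many values of the lift. *)
Lemma finitely_presented_lift (D : algebra) (A : nat -> algebra)
    (U : set_system nat) (UF : Filter U) (l : D -> reduced_product A UF)
    (S : set (D * product A)) :
  finitely_presented V D -> (forall n, V (A n)) -> hom l ->
  finite_set S -> (forall da, S da -> l da.1 = class_of UF da.2) ->
  U [set n | exists2 h : D -> A n, hom h &
    forall da, S da -> h da.1 = da.2 n].
Proof.
move=> [m [F [g [R [[VF F_free] Rfin [phi [phi_hom [psi phiK psiK]]]]]]]].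
move=> VA l_hom Sfin lS; set q := quotient_map (generated_congruenceP R).
pose p := psi \o q.
have psi_hom : hom psi.
  split=> [o x y|]; last by rewrite -phi_hom.2 phiK.
  by rewrite -{1}[x]psiK -{1}[y]psiK -phi_hom.1 phiK.
have p_hom : hom p by apply: hom_comp psi_hom (quotient_map_hom _).
have p_surj d : exists t, p t = d.
  have [t tE] := quotient_map_surj (phi d); exists t.
  by rewrite /p /= /q tE phiK.
have [c cE] := choice (fun k => class_of_surj (l (p (g k)))).
have VP : V (product A) by exact: variety_product.
have [r [[r_hom rg] _]] := F_free _ c VP.
(* Both sides are homomorphisms from the free algebra that agree on the generators. *)
have lp : l \o p = class_of UF \o r.
  have VU : V (reduced_product A UF) by exact: variety_quotient.
  have [h [_ h_unique]] := F_free _ (l \o p \o g) VU.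
  rewrite -(h_unique (l \o p)) ?(h_unique (class_of UF \o r)) //.
    split=> [|k]; last by rewrite /= rg cE.
    by apply: hom_comp (class_of_hom _ _) r_hom.
  by split=> //; exact: hom_comp.
have rR (st : F * F) : R st -> U [set n | r st.1 n = r st.2 n].
  move=> Rst; apply/(quotient_mapE (almost_eq_congruence A UF)).
  rewrite -/(class_of UF) -[LHS]/((class_of UF \o r) st.1).
  rewrite -[RHS]/((class_of UF \o r) st.2) -lp /= /p /=; congr (l (psi _)).
  by apply/quotient_mapE => th _; apply; case: st Rst.
have [t tE] := choice p_surj.
have rS da : S da -> U [set n | r (t da.1) n = da.2 n].
  move=> Sda; apply/(quotient_mapE (almost_eq_congruence A UF)).
  rewrite -/(class_of UF) -lS // -[LHS]/((class_of UF \o r) (t da.1)) -lp /=.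
  by rewrite tE.
apply: filterS (filterI (filter_finite UF Rfin rR) (filter_finite UF Sfin rS)).
move=> n [/= Rn Sn]; have rn_hom : hom (fun s => r s n).
  exact: (hom_comp (proj_hom A n) r_hom).
have rn_R s s' : generated_congruence R s s' -> r s n = r s' n.
  by apply: (generated_congruence_kernel rn_hom) => u u' /Rn.
have [h h_hom hE] := quotient_lift (generated_congruenceP R) rn_hom rn_R.
exists (h \o phi); first exact: hom_comp.
by move=> da Sda /=; rewrite -Sn // -hE -[in LHS](tE da.1) /p /= psiK.
Qed.

Lemma not_coherent : ~ coherent V.
Proof.
move=> V_coherent.
have [F [g Fg]] := free_algebra_exists V_variety 'I_3.
pose x0 := g (inord 0); pose w0 := g (inord 1); pose z0 := g (inord 2).
pose R : set (F * F) := [set (bop Meet w0 x0, w0); (bop Meet x0 (ident F), x0);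
  (bop Mul (negpart z0) x0, x0)].
have Rfin : finite_set R.
  by rewrite /R !finite_setU; do !split; exact: finite_set1.
pose G := quotient (generated_congruenceP R).
pose q : F -> G := quotient_map (generated_congruenceP R).
have q_hom : hom q by exact: quotient_map_hom.
have VG : V G by apply: (variety_quotient V_variety); case: Fg.
have GE : fixpoint_system (q w0) (q z0) (q x0).
  have RE s t : R (s, t) -> q s = q t.
    by move=> Rst; apply/quotient_mapE => th _; apply.
  split; first by rewrite -q_hom.1; apply: RE; left; left.
    by rewrite -q_hom.2 -q_hom.1; apply: RE; left; right.
  by rewrite -hom_negpart // -q_hom.1; apply: RE; right.
pose X : set G := [set q w0; q z0].
have D_fp := V_coherent _ VG (finitely_presented_quotient Fg Rfin) X
  (finite_set2 _ _).
set D := subalgebra _ in D_fp.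
have Dw0 : generated_sub X (q w0) by move=> S _; apply; left.
have Dz0 : generated_sub X (q z0) by move=> S _; apply; right.
pose w1 : D := exist _ _ Dw0; pose z1 : D := exist _ _ Dz0.
have [A [w [z gap]]] := power_gap_exists.
have [U [U_ultra ooU]] := ultraFilterLemma eventually_filter.
have [B [j [x [VB j_hom j_inj xE]]]] :=
  power_gap_ultraproduct _ ooU gap.
set P := reduced_product _ _ in j j_hom j_inj xE *.
(* [B] contains a solution of Sigma, so the algebra presented by Sigma maps to it. *)
have [k k_hom [kw kz]] : exists2 k : G -> B, hom k &
    k (q w0) = j (class_of _ w) /\ k (q z0) = j (class_of _ z).
  have [f [[f_hom fg] _]] := Fg.2 B (fun i : 'I_3 =>
    assign x (j (class_of _ w)) (j (class_of _ z)) i) VB.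
  have [|k k_hom kE] := quotient_lift (generated_congruenceP R) f_hom.
    move=> s t; apply: (generated_congruence_kernel f_hom).
    have [wx xe zx] := xE.
    have fx : f x0 = x by rewrite /x0 fg inordK.
    have fw : f w0 = j (class_of _ w) by rewrite /w0 fg inordK.
    have fz : f z0 = j (class_of _ z) by rewrite /z0 fg inordK.
    by move=> _ _ [[[-> ->]|[-> ->]]|[-> ->]];
      rewrite f_hom.1 ?hom_negpart ?f_hom.2 ?fx ?fw ?fz.
  by exists k; rewrite // /q !kE /w0 /z0 !fg !inordK.
(* The preimage under [k] of the image of [j] is a subuniverse containing both generators of [D];
   hence [k] restricted to [D] factors through the ultraproduct. *)
have kj (d : D) : exists u, j u = k (sval d).
  case: d => d Dd /=; apply: (Dd [set d | exists u, j u = k d]).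
    split; first by exists (ident P); rewrite j_hom.2 k_hom.2.
    move=> o a b /= [u uE] [v vE]; exists (@bop P o u v).
    by rewrite j_hom.1 k_hom.1 uE vE.
  by move=> _ [->|->]; [exists (class_of _ w)|exists (class_of _ z)].
have [l lE] := choice kj.
have l_hom : hom l.
  split=> [o c d|]; apply: j_inj; rewrite lE ?j_hom.1 ?j_hom.2 ?lE /=.
    by rewrite k_hom.1.
  by rewrite k_hom.2.
have lw : l w1 = class_of _ w by apply: j_inj; rewrite lE.
have lz : l z1 = class_of _ z by apply: j_inj; rewrite lE.
have VA n : V (A n) by have [] := gap n.
pose S : set (D * product A) := [set (w1, w); (z1, z)].
have [|n [h h_hom hS]] := filter_ex
    (finitely_presented_lift D_fp VA l_hom (finite_set2 _ _ : finite_set S) _).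
  by move=> _ [->|->].
have hw : h w1 = w n by exact: (hS (w1, w) (or_introl erefl)).
have hz : h z1 = z n by exact: (hS (z1, z) (or_intror erefl)).
(* w <= c^(n+1) holds in [G], thus in its subalgebra [D], and the lift [h] carries it to [A n]. *)
have [_ [_]] := gap n; apply; rewrite -hw -hz -hom_negpower //.
apply: hom_le => //; apply: (hom_le_inj (sval_hom _)).
  by move=> [d Dd] [e De] /= de; exact: eq_exist.
rewrite (hom_negpower (sval_hom _)).
exact: fixpoint_bound (V_rl VG) GE.
Qed.

(** * Nonexistence of a model completion *)

Lemma no_model_completion Tstar : ~ model_completion (Th V) Tstar.
Proof.
move=> [Tstar_th Th_Tstar embed complete].
have [A [w' [z' gapA]]] := power_gap_exists.
(* Gaps survive embeddings, and models of [Tstar] lie in [V] because [Tstar] contains [Th V]. *)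
have H n : exists (B : algebra) (w z : B),
    [/\ model Tstar (of_void B), V B & power_gap n w z].
  have [VA gap] := gapA n.
  have [B [h [BT h_hom h_inj]]] := embed _ ((model_Th _ V_variety).2 VA).
  exists B, (h (w' n)), (h (z' n)); split=> //; last exact: power_gap_hom.
  by apply/(model_Th _ V_variety) => phi /Th_Tstar; exact: BT.
pose M n := sval (cid (H n)); pose HM n := svalP (cid (H n)).
pose w : product M := fun n => sval (cid (HM n)).
pose z : product M := fun n => sval (cid (svalP (cid (HM n)))).
have MP n : [/\ model Tstar (of_void (M n)), V (M n) & power_gap n (w n) (z n)].
  exact: (svalP (cid (svalP (cid (HM n))))).
have gap n : V (M n) /\ power_gap n (w n) (z n) by have [] := MP n.
have [U [U_ultra ooU]] := ultraFilterLemma eventually_filter.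
have [B [j [x [VB j_hom j_inj xE]]]] :=
  power_gap_ultraproduct _ ooU gap.
set P := reduced_product _ _ in j j_hom j_inj xE *.
pose wP : P := class_of _ w; pose zP : P := class_of _ z.
have PT : model Tstar (of_void P).
  move=> phi Tphi v; have [u uE] := choice (fun k => class_of_surj (v k)).
  have -> : v = class_of _ \o u by apply/funext => k /=; rewrite uE.
  rewrite -(of_void_comp (class_of _)); apply/ultraproduct_holds.
  apply: filterS filterT => n _ /=; have [MT _ _] := MP n.
  rewrite (_ : (fun c => _) = of_void (M n)); first exact: MT.
  by apply/funext => -[].
have VP : V P by apply/(model_Th _ V_variety) => phi /Th_Tstar; exact: PT.
have [Q [h [QT h_hom h_inj]]] := embed _ ((model_Th _ V_variety).2 VB).
have k_hom : hom (h \o j) := hom_comp h_hom j_hom.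
have k_inj : injective (h \o j) by exact: inj_comp.
have [_ decide] := complete _ ((model_Th _ V_variety).2 VP).
(* Two models of the allegedly complete theory disagree: [Q], reached through [B], has a solution of
   Sigma, and [P] has none. *)
have [yes|no] := decide _ (no_fixpoint_sentence wP zP).
  have QD : model ([set map_formula (of_void P) phi | phi in Tstar]
      `|` @diagram P) (h \o j).
    move=> psi [[phi Tphi <-]|[psi_qf psi_s psiP]] v.
      by apply/holds_map_formula; rewrite of_void_comp; exact: QT.
    (* The truth of a sentence does not depend on the valuation, so one coming from [P] is
       substituted. *)
    apply: (holds_sentence (u := (h \o j) \o fun=> ident P)) => //.
    by apply/(holds_embedding id); [exact: k_hom|exact: k_inj|..].
  have /no_fixpointP /(_ (h x)) := yes _ _ QD (fun=> ident Q).
  by apply; exact: (hom_fixpoint_system h_hom xE).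
have PD : model ([set map_formula (of_void P) phi | phi in Tstar]
    `|` @diagram P) id.
  move=> psi [[phi Tphi <-]|[_ _ psiP]] v; last exact: psiP.
  by apply/holds_map_formula; rewrite of_void_comp; exact: PT.
apply: (no _ _ PD (fun=> ident P)); apply/no_fixpointP => y.
(* A solution in [P] would give one in some [M n], against the gap there. *)
have [a <-] := class_of_surj y => /reduced_product_fixpoint /filter_ex [n].
by have [VM gapn] := gap n; exact: (power_gap_no_fixpoint VM gapn).
Qed.

End Counterexample.

Theorem corollary5p11 (V C : class)
  (C_rl : forall A, C A -> residuated_lattice A)
  (V_ISP : forall A, V A <-> ISP C A)
  (V_variety : variety V)
  (C_canonical : closed_under_canonical_extensions C)
  (V_not_potent : forall n : nat, ~ eqn_valid V (neg_potent_eqn n)) :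
  ~ coherent V /\
  ~ right_uniform_deductive_interpolation V /\
  ~ (exists Tstar, model_completion (Th V) Tstar).
Proof.
split; last split.
- exact: not_coherent C_rl V_ISP V_variety C_canonical V_not_potent.
- exact: no_right_uniform_deductive_interpolation C_rl V_ISP V_variety
    C_canonical V_not_potent.
- move=> [Tstar].
  exact: no_model_completion C_rl V_ISP V_variety C_canonical V_not_potent
    Tstar.
Qed.
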